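(* If $G$ is a simple connected graph of diameter at most $2$ that is not a path, then $md(G)=\infty$.
   Context: For vertices $u,v$ of a connected graph $G$, $d(u,v)$ is the length of a shortest $u$–$v$ path. For $W\subseteq V(G)$ and $v\in V(G)$, $r_m(v|W)$ is the multiset $\{d(v,w): w\in W\}$. $W$ is an m-resolving set if $r_m(u|W)\neq r_m(v|W)$ for all distinct $u,v\in V(G)$. If $G$ has an m-resolving set, $md(G)$ is the minimum cardinality of one; otherwise $md(G)=\infty$. *)

(* Defs.v *)
From mathcomp Require Import all_boot finmap multiset.

Set Implicit Arguments.
Unset Strict Implicit.
Unset Printing Implicit Defensive.

Section Graph.

(* A graph is given by its adjacency relation [e] on its finite vertex type. *)
Variables (T : finType) (e : rel T).

Definition simple_graph : Prop := symmetric e /\ irreflexive e.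

(* The null graph is not connected. *)
Definition connected_graph : Prop :=
  0 < #|T| /\ forall u v : T, connect e u v.

Definition has_path (u v : T) (n : nat) : bool :=
  [exists p : n.-tuple T, [&& path e u p, last u p == v & uniq (u :: p)]].

(* A path visits distinct vertices, so its length is less than #|T|; the value
   is #|T| when u and v are not connected. *)
Definition dist (u v : T) : nat := find (has_path u v) (iota 0 #|T|).

Definition diam : nat := \max_(u : T) \max_(v : T) dist u v.

Definition is_path_graph : Prop :=
  exists n : nat, exists2 f : 'I_n.+1 -> T, bijective f &
    forall i j : 'I_n.+1, e (f i) (f j) = (i.+1 == j) || (j.+1 == i).

Definition rm (v : T) (W : {set T}) : {mset nat}%mset :=
  seq_mset [seq dist v w | w in W].

Definition m_resolving (W : {set T}) : bool :=
  [forall u, forall v, (u != v) ==> (rm u W != rm v W)].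

(* [None] stands for infinity. *)
Definition md : option nat :=
  if [pick W | m_resolving W] is Some W0
  then Some #|[arg min_(W < W0 | m_resolving W) #|W|]| else None.

End Graph.

(* Main.v *)
(* With diameter at most 2, the multiset of distances from a vertex of [W] to
   [W] is determined by the degree of that vertex in the subgraph induced by
   [W].  As two vertices of a graph on at least two vertices always share the
   same degree, a resolving [W] has at most one element [w].  Then the distance
   to [w] tells all vertices apart, so there is at most one vertex at each of
   the distances 0, 1, 2, and the graph is a path starting at [w]. *)
Require Import Defs.
From mathcomp Require Import all_boot.
From mathcomp Require Import finmap multiset.

(** Degrees inside [W] lie below [#|W|], so if they were distinct, each value from 0 to [#|W|.-1]
    would occur. For [#|W| >= 2] the vertex of top degree is adjacent to all others, including the
    isolated one, which is absurd. *)
Lemma distinct_degrees (T : finType) (e : rel T) (W : {set T}) :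
  symmetric e -> irreflexive e ->
  {in W &, injective (fun v => #|[set w in W | e v w]|)} -> #|W| <= 1.
Proof.
move=> sym irr inj; rewrite leqNgt; apply/negP => W2.
pose f v := #|[set w in W | e v w]|.
have f_lt v : v \in W -> f v < #|W|.
  move=> vW; rewrite (cardsD1 v W) vW add1n ltnS; apply: subset_leq_card.
  apply/subsetP=> w; rewrite !inE => /andP[-> evw]; rewrite andbT.
  by apply: contraTneq evw => ->; rewrite irr.
have f_onto i : i < #|W| -> exists2 v, v \in W & f v = i.
  have uf : uniq [seq f v | v <- enum W].
    rewrite map_inj_in_uniq ?enum_uniq // => x y.
    by rewrite !mem_enum; apply: inj.
  have sub : {subset [seq f v | v <- enum W] <= iota 0 #|W|}.
    by move=> _ /mapP[v + ->]; rewrite mem_enum mem_iota => /f_lt.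
  have [|_ eq_f] := uniq_min_size uf sub; first by rewrite size_map size_iota -cardE.
  move=> iW; have : i \in iota 0 #|W| by rewrite mem_iota.
  by rewrite -eq_f => /mapP[v + ->]; rewrite mem_enum; exists v.
have [x xW fx] := f_onto 0 (ltnW W2).
have [y yW fy] := f_onto #|W|.-1 (ltac:(by case: #|W| W2)).
have neq_yx : y != x.
  by apply: contraTneq W2 => yx; move: fy; rewrite yx fx; case: #|W| => [|[]].
have e_y : [set w in W | e y w] = W :\ y.
  apply/eqP; rewrite eqEcard; apply/andP; split.
    apply/subsetP=> w; rewrite !inE => /andP[-> eyw]; rewrite andbT.
    by apply: contraTneq eyw => ->; rewrite irr.
  by rewrite -/(f y) fy (cardsD1 y W) yW.
have : x \in W :\ y by rewrite !inE eq_sym neq_yx.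
rewrite -e_y inE => /andP[_ eyx].
have : y \in [set w in W | e x w] by rewrite inE yW sym.
by rewrite (cards0_eq fx) inE.
Qed.

Section Distance.

Variables (T : finType) (e : rel T).
Implicit Types (u v w : T) (W : {set T}).

Lemma has_path0 u v : has_path e u v 0 = (u == v).
Proof.
apply/existsP/eqP => [[p]|->]; last by exists [tuple]; rewrite /= eqxx.
by rewrite (tuple0 p) /= andbT => /eqP.
Qed.

Lemma has_path1 u v : irreflexive e -> has_path e u v 1 = e u v.
Proof.
move=> irr; apply/existsP/idP => [[p]|euv].
  by case/tupleP: p => x p; rewrite (tuple0 p) /= andbT => /and3P[? /eqP <-].
exists [tuple v]; rewrite /= euv eqxx /= andbT inE.
by apply: contraTneq euv => ->; rewrite irr.
Qed.

(** Removing repetitions from a walk leaves a path on at most [#|T|] vertices, so [find] succeeds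
    before reaching its default value [#|T|]. *)
Lemma dist_lt u v : connect e u v -> dist e u v < #|T|.
Proof.
case/connectP=> p0 ep0 ->; case/shortenP: ep0 => p ep up _.
rewrite /dist -[ltnRHS](size_iota 0) -has_find; apply/hasP; exists (size p).
  by rewrite mem_iota add0n -[(size p).+1]/(size (u :: p)) -(card_uniqP up) max_card.
by apply/existsP; exists (in_tuple p); rewrite /= ep eqxx.
Qed.

Lemma dist_eq0 u v : (dist e u v == 0) = (u == v).
Proof.
(* The vertex [u] makes [T] nonempty, so 0 is the first length that [find] tries. *)
rewrite /dist -has_path0; case: #|T| (fintype0 (T := T) u) => [/(_ erefl)//|n _].
by rewrite /=; case: has_path.
Qed.

Lemma dist_eq1 u v : irreflexive e -> (dist e u v == 1) = e u v.
Proof.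
move=> irr; have [->|neq] := eqVneq u v.
  by rewrite irr; have/eqP-> : dist e v v == 0 by rewrite dist_eq0.
(* Two distinct vertices ensure that length 1 is among those searched. *)
have : 1 < #|T| by have := max_card [set u; v]; rewrite cards2 neq.
rewrite /dist; case: #|T| => [|[|n]] //= _.
by rewrite has_path0 (negPf neq) has_path1 //; case: e.
Qed.

Lemma dist_le_diam u v : dist e u v <= diam e.
Proof.
by apply: leq_trans (leq_bigmax u); apply: (leq_bigmax (F := dist e u)).
Qed.

Lemma eq_rm W u v :
  (forall i, #|[set w in W | dist e u w == i]|
             = #|[set w in W | dist e v w == i]|) ->
  rm e u W = rm e v W.
Proof.
have count_dist x i :
    count_mem i [seq dist e x w | w in W] = #|[set w in W | dist e x w == i]|.
  rewrite count_map cardE !size_filter count_filter.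
  by apply: eq_count => w; rewrite /= !inE andbC.
by move=> eq_uv; apply/msetP=> i; rewrite !mset_seqE !count_dist.
Qed.

Lemma card_dist0 W v : v \in W -> #|[set w in W | dist e v w == 0]| = 1.
Proof.
move=> vW; rewrite (_ : [set _ in _ | _] = [set v]) ?cards1 //.
apply/setP=> w; rewrite !inE dist_eq0 eq_sym.
by case: eqVneq => [->|]; rewrite ?vW ?andbF.
Qed.

Lemma card_dist_le2 W v : diam e <= 2 ->
  #|[set w in W | dist e v w == 0]| + #|[set w in W | dist e v w == 1]|
    + #|[set w in W | dist e v w == 2]| = #|W|.
Proof.
move=> d2; rewrite -!sum1dep_card -sum1_card !big_mkcondr -!big_split /=.
apply: eq_bigr => w _; have := leq_trans (dist_le_diam v w) d2.
by case: dist => [|[|[]]].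
Qed.

(** For a vertex of [W], distance 0 occurs once and distance 1 as often as its degree in [W]; the
    multiplicity of 2 is then what remains of [#|W|]. *)
Lemma rm_eq_degree W u v : irreflexive e -> diam e <= 2 ->
  u \in W -> v \in W ->
  #|[set w in W | e u w]| = #|[set w in W | e v w]| -> rm e u W = rm e v W.
Proof.
move=> irr d2 uW vW deg.
have dist1 x : [set w in W | dist e x w == 1] = [set w in W | e x w].
  by apply/setP=> w; rewrite !inE dist_eq1.
apply: eq_rm => -[|[|[|i]]]; rewrite ?card_dist0 ?dist1 //.
  have := card_dist_le2 W v d2; rewrite -(card_dist_le2 W u d2).
  by rewrite !card_dist0 // !dist1 deg => /addnI.
suff far x : [set w in W | dist e x w == i.+3] = set0 by rewrite !far.
apply/setP=> w; rewrite !inE ltn_eqF ?andbF //.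
by rewrite ltnS (leq_trans (dist_le_diam x w)) // (leq_trans d2).
Qed.

Lemma rm_set0 u : rm e u set0 = seq_mset [::].
Proof. by rewrite /rm /image_mem enum_set0. Qed.

Lemma rm_set1 u w : rm e u [set w] = seq_mset [:: dist e u w].
Proof. by rewrite /rm /image_mem enum_set1. Qed.

Lemma m_resolvingP W : reflect (injective (fun v => rm e v W)) (m_resolving e W).
Proof.
apply: (iffP forallP) => [res u v /eqP eq_uv | inj u].
  by move/forallP/(_ v): (res u); rewrite eq_uv implybF negbK => /eqP.
by apply/forallP=> v; apply/implyP; apply: contraNneq => /inj ->.
Qed.

Lemma inj_dist_path w : simple_graph e -> connected_graph e -> diam e <= 2 ->
  injective (dist e ^~ w) -> is_path_graph e.
Proof.
move=> [sym irr] [T0 conn] d2 inj.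
have d_le v : dist e v w <= 2 := leq_trans (dist_le_diam v w) d2.
have nbr u v : u != v -> exists x, e u x.
  move=> neq; have /connectP[[|x p] /=] := conn u v.
    by move=> _ vu; rewrite vu eqxx in neq.
  by case/andP=> eux _ _; exists x.
(* Any neighbour [x] of [v] will do: its distance to [w] is not 0, since [v] is not adjacent to [w],
   and not 2, since [x] would be [v]. So it is 1, and [x] is [u]. *)
have e12 u v : dist e u w = 1 -> dist e v w = 2 -> e u v.
  move=> du dv; have vw : v != w by rewrite -dist_eq0 dv.
  have [x evx] := nbr v w vw.
  suff -> : u = x by rewrite sym.
  apply: (inj); rewrite du; move: (d_le x) (dist_eq0 x w) evx.
  case dx : (dist e x w) => [|[|[|//]]] // _.
    by move/esym/eqP=> ->; rewrite -dist_eq1 // dv.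
  by move=> _; rewrite (inj x v) ?irr // dx dv.
(* Adjacency means that the distances to [w] differ by exactly one, as for consecutive indices of a
   path. *)
have e_dist u v :
    e u v = ((dist e u w).+1 == dist e v w) || ((dist e v w).+1 == dist e u w).
  have [eq_d|neq_d] := eqVneq (dist e u w) (dist e v w).
    by rewrite eq_d (inj u v) // irr gtn_eqF.
  wlog lt_d : u v neq_d / dist e u w < dist e v w.
    move=> H; case: (ltngtP (dist e u w) (dist e v w)) => [||eq_d]; first exact: H.
      by rewrite sym orbC; apply: H; rewrite eq_sym.
    by rewrite eq_d eqxx in neq_d.
  move: (d_le v) (e12 u v) (dist_eq0 u w) (dist_eq1 v w irr) lt_d.
  case: (dist e v w) (dist e u w) => [|[|[|//]]] [|[|//]] //= _ e_uv eq_u.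
  1,2: by move: (esym eq_u) => /eqP->; rewrite sym => <-.
  by rewrite e_uv.
case card_T : #|T| T0 => [//|n] _.
(* The distance to [w] is thus an injection of [T] into a set of the same size; its inverse [f]
   lists the vertices along the path. *)
have lt_d v : dist e v w < n.+1 by rewrite -card_T dist_lt.
have g_inj : injective (fun v => Ordinal (lt_d v)).
  by move=> u v [/inj].
have [|f fK gK] := inj_card_bij g_inj; first by rewrite card_ord card_T.
exists n, f; first by exists (fun v => Ordinal (lt_d v)).
have dist_f k : dist e (f k) w = k := congr1 val (gK k).
by move=> i j; rewrite e_dist !dist_f.
Qed.

End Distance.

Theorem theorem3p2 (T : finType) (e : rel T)
    (e_simple : simple_graph e) (e_connected : connected_graph e)
    (e_diam : diam e <= 2) (e_not_path : ~ is_path_graph e) :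
  md e = None.
Proof.
rewrite /md; case: pickP => // W /m_resolvingP res; case: e_not_path.
have [sym irr] := e_simple; have [/card_gt0P[w0 _] _] := e_connected.
suff [w inj] : exists w, injective (dist e ^~ w) by apply: inj_dist_path inj.
have : #|W| <= 1.
  apply: (distinct_degrees _ e) => // u v uW vW deg.
  by apply: res; apply: rm_eq_degree.
rewrite leq_eqVlt ltnS leqn0 cards_eq0 => /orP[/cards1P[w W1] | /eqP W0].
  by exists w => u v /= eq_d; apply: res; rewrite W1 !rm_set1 eq_d.
(* An empty resolving set gives every vertex the empty multiset, so there is only one vertex and
   [w0] serves. *)
by exists w0 => u v _; apply: res; rewrite W0 !rm_set0.
Qed.
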